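(* Let $H$ be a Hopf algebra over a field $\Bbbk$ and let $(A,\rho_A)$ be a right $H$-comodule algebra. If $(A\otimes H^{\mathrm{op}},H,\psi)$ is a Frobenius cowreath, then it is also h-separable.
   Context: Everything is over a field $\Bbbk$, $\otimes=\otimes_{\Bbbk}$, and Sweedler notation with suppressed summation is used. $H$ is a Hopf algebra with counit $\varepsilon$ and antipode $S$; $H^{\mathrm{op}}$ is $H$ with opposite multiplication. A right $H$-comodule algebra $(A,\rho_A)$ is a unital associative algebra $A$ which is a right $H$-comodule via an algebra map $\rho_A:A\to A\otimes H$, $\rho_A(a)=a_0\otimes a_1$ (iterated: $a_0\otimes a_1\otimes a_2$, etc.). With $\psi:H\otimes A\otimes H^{\mathrm{op}}\to A\otimes H^{\mathrm{op}}\otimes H$, $\psi(h\otimes a\otimes l)=a_0\otimes l_1\otimes l_2ha_1$, one has a cowreath $(A\otimes H^{\mathrm{op}},H,\psi)$. Convention: whenever a multiplication symbol is omitted, products in $A\otimes H$ are computed with the ordinary multiplications of $A$ and of $H$ (not the opposite one). A Casimir morphism for $(H,\psi)$ is a $\Bbbk$-linear map $B:H\otimes H\to A\otimes H^{\mathrm{op}}$, written $B(h\otimes h')=B^A(h\otimes h')\otimes B^H(h\otimes h')$, such that for all $a\in A$, $g,h,h'\in H$: $$(a_0\otimes 1_H)B(g_2ha_1\otimes g_3h'a_2)(1_A\otimes g_1)=(1_A\otimes g)B(h\otimes h')(a\otimes 1_H),$$ $$B^A(h_2\otimes h')_0\otimes B^H(h_2\otimes h')_1\otimes B^H(h_2\otimes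 h')_2h_1B^A(h_2\otimes h')_1=B(h\otimes h'_1)\otimes h'_2.$$ The cowreath $(A\otimes H^{\mathrm{op}},H,\psi)$ is h-separable if there is a Casimir morphism $B$ which is normalized, i.e. $B(h_1\otimes h_2)=\varepsilon(h)1_A\otimes 1_H$ for all $h\in H$, and satisfies, for all $h,h',h''\in H$, $$B^A(h\otimes h'_1)B^A(h'_2\otimes h'')\otimes B^H(h'_2\otimes h'')B^H(h\otimes h'_1)=\varepsilon(h')B(h\otimes h'').$$ The cowreath is Frobenius if there are a Casimir morphism $B$ and an element $\mathfrak{t}=\mathfrak{t}^1\otimes\mathfrak{t}^2\otimes\mathfrak{t}^3\in A\otimes H\otimes H$ such that for all $a\in A$, $h\in H$: $$a\mathfrak{t}^1\otimes\mathfrak{t}^2h\otimes\mathfrak{t}^3=\mathfrak{t}^1a_0\otimes h_1\mathfrak{t}^2\otimes h_2\mathfrak{t}^3a_1,$$ $$(\mathfrak{t}^1\otimes 1_H)B(\mathfrak{t}^3\otimes h)(1_A\otimes\mathfrak{t}^2)=\varepsilon(h)1_A\otimes 1_H=(\mathfrak{t}^1_0\otimes 1_H)B(\mathfrak{t}^2_2h\mathfrak{t}^1_1\otimes\mathfrak{t}^3)(1_A\otimes\mathfrak{t}^2_1).$$ *)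

(* Defs.v *)
From HB Require Import structures.
From mathcomp Require Import all_boot all_order all_algebra.
From mathcomp Require Import boolp.

Set Implicit Arguments.
Unset Strict Implicit.
Unset Printing Implicit Defensive.

Import GRing.Theory.
Local Open Scope ring_scope.
Local Open Scope quotient_scope.

Reserved Notation "x ⊗ y" (at level 45, left associativity).
Reserved Notation "\sw_ ( x ⊗ y <- t ) E"
  (at level 46, x name, y name, t at level 60, E at level 46,
   format "'[' \sw_ ( x  ⊗  y  <-  t ) '/  '  E ']'").
Reserved Notation "\sw_ ( x ⊗ y ⊗ z <- t ) E"
  (at level 46, x name, y name, z name, t at level 60, E at level 46,
   format "'[' \sw_ ( x  ⊗  y  ⊗  z  <-  t ) '/  '  E ']'").

(* Unital associative algebras over k. The library's algType is not used      *)
(* because it excludes the zero algebra.                                      *)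
HB.mixin Record Lmodule_isPzAlgebra (k : fieldType) A of GRing.Lmodule k A := {
  pzalg_one : A;
  pzalg_mul : A -> A -> A;
  pzalg_mulA : associative pzalg_mul;
  pzalg_mul1l : left_id pzalg_one pzalg_mul;
  pzalg_mul1r : right_id pzalg_one pzalg_mul;
  pzalg_mulDl : left_distributive pzalg_mul +%R;
  pzalg_mulDr : right_distributive pzalg_mul +%R;
  pzalg_scaleAl : forall (c : k) (x y : A),
    c *: pzalg_mul x y = pzalg_mul (c *: x) y;
  pzalg_scaleAr : forall (c : k) (x y : A),
    c *: pzalg_mul x y = pzalg_mul x (c *: y)
}.

#[short(type="pzAlgType")]
HB.structure Definition PzAlgebra (k : fieldType) :=
  {A of GRing.Lmodule k A & Lmodule_isPzAlgebra k A}.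

HB.instance Definition _ (k : fieldType) (A : pzAlgType k) :=
  GRing.Zmodule_isPzRing.Build A (@pzalg_mulA k A) (@pzalg_mul1l k A)
    (@pzalg_mul1r k A) (@pzalg_mulDl k A) (@pzalg_mulDr k A).

Section Tensor.
Variables (k : fieldType) (V W : lmodType k).

(* A list [:: (v1, w1); ...; (vn, wn)] stands for the formal sum of the       *)
(* vi ⊗ wi; tens_eq is the congruence generated by bilinearity.               *)
Inductive tens_eq : seq (V * W) -> seq (V * W) -> Prop :=
| TensRefl s : tens_eq s s
| TensSym s t : tens_eq s t -> tens_eq t s
| TensTrans s t u : tens_eq s t -> tens_eq t u -> tens_eq s u
| TensCat s s' t t' :
    tens_eq s s' -> tens_eq t t' -> tens_eq (s ++ t) (s' ++ t')
| TensComm s t : tens_eq (s ++ t) (t ++ s)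
| Tens0 w : tens_eq [:: (0, w)] [::]
| TensDl v v' w : tens_eq [:: (v + v', w)] [:: (v, w); (v', w)]
| TensDr v w w' : tens_eq [:: (v, w + w')] [:: (v, w); (v, w')]
| TensZ (c : k) v w : tens_eq [:: (c *: v, w)] [:: (v, c *: w)].

Definition tens_rel : rel (seq (V * W)) := fun s t => `[< tens_eq s t >].

Lemma tens_rel_refl : reflexive tens_rel.
Proof. by move=> s; apply/asboolP; apply: TensRefl. Qed.

Lemma tens_rel_sym : symmetric tens_rel.
Proof. by move=> s t; apply/asboolP/asboolP; apply: TensSym. Qed.

Lemma tens_rel_trans : transitive tens_rel.
Proof.
by move=> t s u /asboolP st /asboolP tu; apply/asboolP; apply: TensTrans tu.
Qed.

Canonical tens_equiv :=
  EquivRel tens_rel tens_rel_refl tens_rel_sym tens_rel_trans.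

Definition tensor : Type := {eq_quot tens_rel}.

HB.instance Definition _ := Choice.on tensor.
HB.instance Definition _ : EqQuotient _ tens_rel tensor := EqQuotient.on tensor.

Definition tens (v : V) (w : W) : tensor := \pi_tensor [:: (v, w)].

Lemma tens_piP s t : reflect (\pi_tensor s = \pi_tensor t) (tens_rel s t).
Proof. exact: eqmodP. Qed.

Lemma tens_pi_eq s t : tens_eq s t -> \pi_tensor s = \pi_tensor t.
Proof. by move=> st; apply/tens_piP/asboolP. Qed.

Lemma tens_eq_repr s : tens_eq (repr (\pi_tensor s)) s.
Proof. by apply/asboolP; apply/tens_piP; rewrite reprK. Qed.

Definition tens_zero : tensor := \pi_tensor [::].
Definition tens_add (x y : tensor) : tensor := \pi_tensor (repr x ++ repr y).
Definition tens_scale (c : k) (x : tensor) : tensor :=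
  \pi_tensor [seq (c *: p.1, p.2) | p <- repr x].
Definition tens_opp (x : tensor) : tensor := tens_scale (- 1) x.

Lemma tens_add_pi s t :
  tens_add (\pi_tensor s) (\pi_tensor t) = \pi_tensor (s ++ t).
Proof. by apply: tens_pi_eq; apply: TensCat; apply: tens_eq_repr. Qed.

Lemma tens_scale_eq c s t : tens_eq s t ->
  tens_eq [seq (c *: p.1, p.2) | p <- s] [seq (c *: p.1, p.2) | p <- t].
Proof.
elim=> {s t} /=.
- by move=> s; apply: TensRefl.
- by move=> s t _; apply: TensSym.
- by move=> s t u _ st _; apply: TensTrans.
- by move=> s s' t t' _ ss' _ tt'; rewrite !map_cat; apply: TensCat.
- by move=> s t; rewrite !map_cat; apply: TensComm.
- by move=> w; rewrite scaler0; apply: Tens0.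
- by move=> v v' w; rewrite scalerDr; apply: TensDl.
- by move=> v w w'; apply: TensDr.
- by move=> d v w; rewrite scalerA mulrC -scalerA; apply: TensZ.
Qed.

Lemma tens_scale_pi c s :
  tens_scale c (\pi_tensor s) = \pi_tensor [seq (c *: p.1, p.2) | p <- s].
Proof. by apply: tens_pi_eq; apply: tens_scale_eq; apply: tens_eq_repr. Qed.

Lemma tens_addA : associative tens_add.
Proof.
elim/quotW=> x; elim/quotW=> y; elim/quotW=> z.
by rewrite (tens_add_pi y) (tens_add_pi x) (tens_add_pi x) tens_add_pi catA.
Qed.

Lemma tens_addC : commutative tens_add.
Proof.
elim/quotW=> x; elim/quotW=> y; rewrite !tens_add_pi.
by apply: tens_pi_eq; apply: TensComm.
Qed.

Lemma tens_add0 : left_id tens_zero tens_add.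
Proof. by elim/quotW=> x; rewrite tens_add_pi. Qed.

Lemma tens_eqDs a b s :
  tens_eq ([seq (a *: p.1, p.2) | p <- s] ++ [seq (b *: p.1, p.2) | p <- s])
          [seq ((a + b) *: p.1, p.2) | p <- s].
Proof.
elim: s => [|[v w] s IHs] /=; first exact: TensRefl.
set sa := map _ _ in IHs *; set sb := map _ _ in IHs *.
apply: (@TensTrans _ ([:: (a *: v, w); (b *: v, w)] ++ (sa ++ sb))).
  rewrite -cat1s -[_ :: sb]cat1s.
  rewrite -[[:: _; _]]/([:: (a *: v, w)] ++ [:: (b *: v, w)]) -!catA.
  apply: TensCat; first exact: TensRefl.
  by rewrite !catA; apply: TensCat; [apply: TensComm | apply: TensRefl].
rewrite -[(_, w) :: map _ _]cat1s; apply: TensCat IHs.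
by rewrite scalerDl; apply: TensSym; apply: TensDl.
Qed.

Lemma tens_scaleDl (x : tensor) :
  {morph tens_scale^~ x : a b / a + b >-> tens_add a b}.
Proof.
move=> a b; elim/quotW: x => x; rewrite !tens_scale_pi tens_add_pi.
by apply: tens_pi_eq; apply: TensSym; apply: tens_eqDs.
Qed.

Lemma tens_scale0 x : tens_scale 0 x = tens_zero.
Proof.
elim/quotW: x => s; rewrite tens_scale_pi; apply: tens_pi_eq.
elim: s => [|[v w] s IHs] /=; first exact: TensRefl.
rewrite -cat1s -[[::]]/([::] ++ [::]) scale0r.
by apply: TensCat IHs; apply: Tens0.
Qed.

Lemma tens_scale1 : left_id 1 tens_scale.
Proof.
elim/quotW=> x; rewrite tens_scale_pi; congr (\pi_tensor _).
by rewrite -[RHS]map_id; apply: eq_map => -[v w] /=; rewrite scale1r.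
Qed.

Lemma tens_addN : left_inverse tens_zero tens_opp tens_add.
Proof.
by move=> x; rewrite -{2}[x]tens_scale1 -tens_scaleDl addNr tens_scale0.
Qed.

HB.instance Definition _ :=
  GRing.isZmodule.Build tensor tens_addA tens_addC tens_add0 tens_addN.

Lemma tens_scaleA a b x : tens_scale a (tens_scale b x) = tens_scale (a * b) x.
Proof.
elim/quotW: x => x; rewrite (tens_scale_pi b) !(tens_scale_pi _ _) -map_comp.
congr (\pi_tensor _).
by apply: eq_map => -[v w] /=; rewrite scalerA.
Qed.

Lemma tens_scaleDr : right_distributive tens_scale +%R.
Proof.
move=> a; elim/quotW=> x; elim/quotW=> y.
rewrite [_ + _]tens_add_pi !tens_scale_pi.
by rewrite [RHS]tens_add_pi map_cat.
Qed.

HB.instance Definition _ := GRing.Zmodule_isLmodule.Build k tensor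
  tens_scaleA tens_scale1 tens_scaleDr (fun x => @tens_scaleDl x).

Lemma tens_linearl w : linear (tens^~ w).
Proof.
move=> c v v'; rewrite -[RHS]/(tens_add (tens_scale c (tens v w)) (tens v' w)).
rewrite [tens_scale _ _]tens_scale_pi tens_add_pi.
exact: tens_pi_eq (TensDl _ _ _).
Qed.

Lemma tens_linearr v : linear (tens v).
Proof.
move=> c w w'; rewrite -[RHS]/(tens_add (tens_scale c (tens v w)) (tens v w')).
rewrite [tens_scale _ _]tens_scale_pi tens_add_pi.
apply: tens_pi_eq; apply: TensTrans (TensDr _ _ _) _.
rewrite -cat1s; apply: TensCat (TensRefl _).
by apply: TensSym; apply: TensZ.
Qed.

(* For bilinear f this is the linear map on the tensor product induced by f   *)
(* (sweedler_linear, sweedlerE), i.e. the sum of f x y over any decomposition *)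
(* of t as a sum of pure tensors x ⊗ y. For other f it has no meaning, as it  *)
(* then depends on the chosen representative of t.                            *)
Definition sweedler (U : zmodType) (t : tensor) (f : V -> W -> U) : U :=
  \sum_(p <- repr t) f p.1 p.2.
Arguments sweedler {U} t f.

Definition is_bilinear (U : lmodType k) (f : V -> W -> U) : Prop :=
  (forall w, linear (f^~ w)) /\ (forall v, linear (f v)).

Lemma tens_pi_sum s : \pi_tensor s = \sum_(p <- s) tens p.1 p.2.
Proof.
elim: s => [|[v w] s IHs]; first by rewrite big_nil.
by rewrite big_cons -IHs; rewrite [RHS]tens_add_pi.
Qed.

Lemma sweedler_tens t : sweedler t tens = t.
Proof. by rewrite /sweedler -tens_pi_sum reprK. Qed.

Section Bilinear.
Variables (U : lmodType k) (f : V -> W -> U).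
Hypothesis f_bilin : is_bilinear f.

Let fl w : linear (f^~ w) := f_bilin.1 w.
Let fr v : linear (f v) := f_bilin.2 v.

Lemma bilinZl c v w : f (c *: v) w = c *: f v w.
Proof.
have f0 : f 0 w = 0.
  by have := fl w (- 1) 0 0; rewrite scaler0 addr0 scaleN1r addNr.
by have := fl w c v 0; rewrite /= f0 !addr0.
Qed.

Lemma bilinZr c v w : f v (c *: w) = c *: f v w.
Proof.
have f0 : f v 0 = 0.
  by have := fr v (- 1) 0 0; rewrite scaler0 addr0 scaleN1r addNr.
by have := fr v c w 0; rewrite f0 !addr0.
Qed.

Lemma bilin_tens_eq s t : tens_eq s t ->
  \sum_(p <- s) f p.1 p.2 = \sum_(p <- t) f p.1 p.2.
Proof.
elim=> {s t} //=.
- by move=> s t u _ -> _ ->.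
- by move=> s s' t t' _ ss' _ tt'; rewrite !big_cat /= ss' tt'.
- by move=> s t; rewrite !big_cat /= addrC.
- by move=> w; rewrite big_seq1 big_nil /= -[0](scale0r 0) bilinZl !scale0r.
- move=> v v' w; rewrite !big_cons !big_nil /= !addr0.
  by have := fl w 1 v v'; rewrite /= !scale1r.
- move=> v w w'; rewrite !big_cons !big_nil /= !addr0.
  by have := fr v 1 w w'; rewrite !scale1r.
- by move=> c v w; rewrite !big_seq1 /= bilinZl bilinZr.
Qed.

Lemma sweedler_pi s : sweedler (\pi_tensor s) f = \sum_(p <- s) f p.1 p.2.
Proof. by apply: bilin_tens_eq; apply: tens_eq_repr. Qed.

Lemma sweedlerE v w : sweedler (tens v w) f = f v w.
Proof. by rewrite sweedler_pi big_seq1. Qed.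

Lemma sweedler_linear : linear (sweedler^~ f).
Proof.
move=> c; elim/quotW=> x; elim/quotW=> y.
rewrite -[c *: _]/(tens_scale _ _) tens_scale_pi.
rewrite -[_ + _]/(tens_add _ _) tens_add_pi !sweedler_pi big_cat; congr (_ + _).
by rewrite big_map scaler_sumr; apply: eq_bigr => p _; rewrite /= bilinZl.
Qed.

End Bilinear.

Lemma tens_eq_linear (U : lmodType k) (f g : tensor -> U) :
  linear f -> linear g -> (forall v w, f (tens v w) = g (tens v w)) -> f =1 g.
Proof.
move=> lf lg fg t; rewrite -[t]sweedler_tens /sweedler.
have z h : linear h -> h (0 : tensor) = 0 :> U.
  by move=> lh; have := lh (- 1) 0 0; rewrite scaler0 addr0 scaleN1r addNr.
elim: (repr t) => [|[v w] s IHs]; first by rewrite big_nil !z.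
rewrite big_cons -[tens _ _]scale1r lf lg fg.
by rewrite IHs.
Qed.

End Tensor.

Arguments tensor {k} (V W)%_type_scope.
Arguments tens {k V W} & v w.
Arguments sweedler {k V W U} t f.
Arguments is_bilinear {k V W U} f.

Notation "V ⊗ W" := (tensor V W) : type_scope.
Notation "v ⊗ w" := (tens v w) : ring_scope.
Notation "\sw_ ( x ⊗ y <- t ) E" := (sweedler t (fun x y => E)) : ring_scope.
Notation "\sw_ ( x ⊗ y ⊗ z <- t ) E" :=
  (sweedler t (fun xy z => sweedler xy (fun x y => E))) : ring_scope.
Section TensorRing.
Variables (k : fieldType) (A B : pzAlgType k).

Lemma pz_mul_linearl (C : pzAlgType k) (y : C) : linear (fun x : C => x * y).
Proof. by move=> c x x'; rewrite mulrDl -[(c *: x) * y]pzalg_scaleAl. Qed.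

Lemma pz_mul_linearr (C : pzAlgType k) (x : C) : linear (fun y : C => x * y).
Proof. by move=> c y y'; rewrite mulrDr -[x * (c *: y)]pzalg_scaleAr. Qed.

Definition tens_one : A ⊗ B := 1 ⊗ 1.
Definition tens_mul (s t : A ⊗ B) : A ⊗ B :=
  \sw_(a ⊗ b <- s) \sw_(a' ⊗ b' <- t) (a * a') ⊗ (b * b').

Lemma tens_mul_bilin2 a b :
  is_bilinear (fun (a' : A) (b' : B) => (a * a') ⊗ (b * b')).
Proof.
split=> [b'|a'] c x y /=.
  by rewrite pz_mul_linearr tens_linearl.
by rewrite pz_mul_linearr tens_linearr.
Qed.

Lemma tens_mul_bilin1 (t : A ⊗ B) :
  is_bilinear (fun (a : A) (b : B) => \sw_(a' ⊗ b' <- t) (a * a') ⊗ (b * b')).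
Proof.
split=> [b|a] c x y /=; move: t; apply: tens_eq_linear => /=.
- by apply: sweedler_linear; apply: tens_mul_bilin2.
- move=> d t t'; rewrite !(sweedler_linear (tens_mul_bilin2 _ _)).
  by rewrite !scalerDr !scalerA [c * d]mulrC addrACA.
- move=> a' b'; rewrite !(sweedlerE (tens_mul_bilin2 _ _)).
  by rewrite pz_mul_linearl tens_linearl.
- by apply: sweedler_linear; apply: tens_mul_bilin2.
- move=> d t t'; rewrite !(sweedler_linear (tens_mul_bilin2 _ _)).
  by rewrite !scalerDr !scalerA [c * d]mulrC addrACA.
- move=> a' b'; rewrite !(sweedlerE (tens_mul_bilin2 _ _)).
  by rewrite pz_mul_linearl tens_linearr.
Qed.

Lemma tens_mul_linearl t : linear (tens_mul^~ t).
Proof. exact: sweedler_linear (tens_mul_bilin1 t). Qed.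

Lemma tens_mulE1 a b t :
  tens_mul (a ⊗ b) t = \sw_(a' ⊗ b' <- t) (a * a') ⊗ (b * b').
Proof. exact: sweedlerE (tens_mul_bilin1 t) a b. Qed.

Lemma tens_mulE a b a' b' :
  tens_mul (a ⊗ b) (a' ⊗ b') = (a * a') ⊗ (b * b').
Proof. by rewrite tens_mulE1 (sweedlerE (tens_mul_bilin2 _ _)). Qed.

Lemma tens_mul_linearr s : linear (tens_mul s).
Proof.
move=> c t t'; move: s; apply: tens_eq_linear.
- exact: tens_mul_linearl.
- move=> d s s'; rewrite !tens_mul_linearl.
  by rewrite !scalerDr !scalerA [c * d]mulrC addrACA.
- move=> a b; rewrite !tens_mulE1.
  exact: sweedler_linear (tens_mul_bilin2 a b) c t t'.
Qed.

Lemma tens_mulA : associative tens_mul.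
Proof.
move=> s t u; move: s; apply: tens_eq_linear.
- exact: tens_mul_linearl.
- by move=> c s s'; rewrite !tens_mul_linearl.
move=> a b; move: t; apply: tens_eq_linear.
- by move=> c t t'; rewrite tens_mul_linearl tens_mul_linearr.
- by move=> c t t'; rewrite tens_mul_linearr tens_mul_linearl.
move=> a' b'; move: u; apply: tens_eq_linear.
- by move=> c u u'; rewrite !tens_mul_linearr.
- exact: tens_mul_linearr.
by move=> a'' b''; rewrite !tens_mulE !mulrA.
Qed.

Lemma tens_mul1l : left_id tens_one tens_mul.
Proof.
apply: tens_eq_linear => [||a b]; [exact: tens_mul_linearr | by [] |].
by rewrite tens_mulE !mul1r.
Qed.

Lemma tens_mul1r : right_id tens_one tens_mul.
Proof.
apply: tens_eq_linear => [||a b]; [exact: tens_mul_linearl | by [] |].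
by rewrite tens_mulE !mulr1.
Qed.

Lemma tens_mulDl : left_distributive tens_mul +%R.
Proof.
by move=> s s' t; have := tens_mul_linearl t 1 s s'; rewrite !scale1r.
Qed.

Lemma tens_mulDr : right_distributive tens_mul +%R.
Proof.
by move=> s t t'; have := tens_mul_linearr s 1 t t'; rewrite !scale1r.
Qed.

(* The usual componentwise product of A ⊗ B.                                  *)
HB.instance Definition _ := GRing.Zmodule_isPzRing.Build (A ⊗ B)%type
  tens_mulA tens_mul1l tens_mul1r tens_mulDl tens_mulDr.

Lemma tensM (a a' : A) (b b' : B) :
  (a ⊗ b) * (a' ⊗ b') = (a * a') ⊗ (b * b').
Proof. exact: tens_mulE. Qed.

Lemma tensZAl (c : k) (s t : A ⊗ B) : c *: (s * t) = (c *: s) * t.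
Proof.
have t0 : tens_mul 0 t = 0 by exact: mul0r.
by have := tens_mul_linearl t c s 0; rewrite addr0 t0 addr0.
Qed.

Lemma tensZAr (c : k) (s t : A ⊗ B) : c *: (s * t) = s * (c *: t).
Proof.
have s0 : tens_mul s 0 = 0 by exact: mulr0.
by have := tens_mul_linearr s c t 0; rewrite addr0 s0 addr0.
Qed.

HB.instance Definition _ := Lmodule_isPzAlgebra.Build k (A ⊗ B)%type
  tens_mulA tens_mul1l tens_mul1r tens_mulDl tens_mulDr tensZAl tensZAr.

End TensorRing.

Structure hopfAlgType (k : fieldType) := HopfAlg {
  hopf_alg :> pzAlgType k;
  comul : {linear hopf_alg -> (hopf_alg ⊗ hopf_alg)%type};
  counit : {scalar hopf_alg};
  antipode : {linear hopf_alg -> hopf_alg};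
  comul_monoid : monoid_morphism comul;
  counit_monoid : monoid_morphism counit;
  comulA : forall h : hopf_alg,
    \sw_(h1 ⊗ h2 <- comul h) comul h1 ⊗ h2 =
    \sw_(h1 ⊗ h' <- comul h) \sw_(h2 ⊗ h3 <- comul h') h1 ⊗ h2 ⊗ h3;
  counitl : forall h : hopf_alg, \sw_(h1 ⊗ h2 <- comul h) counit h1 *: h2 = h;
  counitr : forall h : hopf_alg, \sw_(h1 ⊗ h2 <- comul h) counit h2 *: h1 = h;
  antipodel : forall h : hopf_alg,
    \sw_(h1 ⊗ h2 <- comul h) antipode h1 * h2 = counit h *: (1 : hopf_alg);
  antipoder : forall h : hopf_alg,
    \sw_(h1 ⊗ h2 <- comul h) h1 * antipode h2 = counit h *: (1 : hopf_alg)
}.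

Arguments comul {k H} : rename.
Arguments counit {k H} : rename.
Arguments antipode {k H} : rename.
Arguments comul_monoid {k H} : rename.
Arguments counit_monoid {k H} : rename.
Arguments comulA {k H} h : rename.
Arguments counitl {k H} h : rename.
Arguments counitr {k H} h : rename.
Arguments antipodel {k H} h : rename.
Arguments antipoder {k H} h : rename.

Structure comodAlgType (k : fieldType) (H : hopfAlgType k) := ComodAlg {
  comod_alg :> pzAlgType k;
  coact : {linear comod_alg -> (comod_alg ⊗ H)%type};
  coact_monoid : monoid_morphism coact;
  coactA : forall a : comod_alg,
    \sw_(a0 ⊗ a1 <- coact a) coact a0 ⊗ a1 =
    \sw_(a0 ⊗ a' <- coact a) \sw_(a1 ⊗ a2 <- comul a') a0 ⊗ a1 ⊗ a2;
  coact_counit : forall a : comod_alg,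
    \sw_(a0 ⊗ a1 <- coact a) counit a1 *: a0 = a
}.

Arguments coact {k H A} : rename.
Arguments coact_monoid {k H A} : rename.
Arguments coactA {k H A} a : rename.
Arguments coact_counit {k H A} a : rename.

Section Cowreath.
Variables (k : fieldType) (H : hopfAlgType k) (A : comodAlgType H).

Definition comul3 (h : H) : H ⊗ H ⊗ H :=
  \sw_(h1 ⊗ h2 <- comul h) comul h1 ⊗ h2.

Definition coact3 (a : A) : A ⊗ H ⊗ H :=
  \sw_(a0 ⊗ a1 <- coact a) coact a0 ⊗ a1.

(* The properties below are those of the cowreath (A ⊗ H^op, H, psi) with     *)
(*   psi (h ⊗ a ⊗ l) = a0 ⊗ l1 ⊗ l2 h a1.                                     *)
(* The space A ⊗ H^op is that of A ⊗ H, and all the products below are the    *)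
(* ordinary products of A, H and A ⊗ H, not those of H^op and A ⊗ H^op.       *)
Definition Casimir (B : {linear (H ⊗ H)%type -> (A ⊗ H)%type}) : Prop :=
  (forall (a : A) (g h h' : H),
     \sw_(a0 ⊗ a1 ⊗ a2 <- coact3 a) \sw_(g1 ⊗ g2 ⊗ g3 <- comul3 g)
       (a0 ⊗ 1) * B ((g2 * h * a1) ⊗ (g3 * h' * a2)) * (1 ⊗ g1) =
     (1 ⊗ g) * B (h ⊗ h') * (a ⊗ 1)) /\
  (forall h h' : H,
     \sw_(h1 ⊗ h2 <- comul h) \sw_(b ⊗ l <- B (h2 ⊗ h'))
       \sw_(b0 ⊗ b1 <- coact b) \sw_(l1 ⊗ l2 <- comul l)
         b0 ⊗ l1 ⊗ (l2 * h1 * b1) =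
     \sw_(h'1 ⊗ h'2 <- comul h') B (h ⊗ h'1) ⊗ h'2).

Definition normalized (B : {linear (H ⊗ H)%type -> (A ⊗ H)%type}) : Prop :=
  forall h : H,
    \sw_(h1 ⊗ h2 <- comul h) B (h1 ⊗ h2) = counit h *: ((1 : A) ⊗ (1 : H)).

Definition h_separable : Prop :=
  exists B : {linear (H ⊗ H)%type -> (A ⊗ H)%type},
    [/\ Casimir B, normalized B &
        forall h h' h'' : H,
          \sw_(h'1 ⊗ h'2 <- comul h')
            \sw_(b ⊗ l <- B (h ⊗ h'1)) \sw_(c ⊗ m <- B (h'2 ⊗ h''))
              (b * c) ⊗ (m * l) =
          counit h' *: B (h ⊗ h'')].

Definition Frobenius : Prop :=
  exists (B : {linear (H ⊗ H)%type -> (A ⊗ H)%type}) (t : A ⊗ H ⊗ H),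
    [/\ Casimir B,
        forall (a : A) (h : H),
          \sw_(t1 ⊗ t2 ⊗ t3 <- t) (a * t1) ⊗ (t2 * h) ⊗ t3 =
          \sw_(t1 ⊗ t2 ⊗ t3 <- t)
            \sw_(a0 ⊗ a1 <- coact a) \sw_(h1 ⊗ h2 <- comul h)
              (t1 * a0) ⊗ (h1 * t2) ⊗ (h2 * t3 * a1),
        forall h : H,
          \sw_(t1 ⊗ t2 ⊗ t3 <- t) (t1 ⊗ 1) * B (t3 ⊗ h) * (1 ⊗ t2) =
          counit h *: ((1 : A) ⊗ (1 : H)) &
        forall h : H,
          \sw_(t1 ⊗ t2 ⊗ t3 <- t)
            \sw_(x0 ⊗ x1 <- coact t1) \sw_(y1 ⊗ y2 <- comul t2)
              (x0 ⊗ 1) * B ((y2 * h * x1) ⊗ t3) * (1 ⊗ y1) =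
          counit h *: ((1 : A) ⊗ (1 : H))].

End Cowreath.

Arguments h_separable {k} H A.
Arguments Frobenius {k} H A.

(* Main.v *)
(* If the antipode S is bijective, then B(h ⊗ h') = 1 ⊗ h' S^-1(h) is a
   normalized Casimir morphism with the h-separability property, whatever the
   comodule algebra A. If A = 0 there is nothing to prove, so it suffices to
   show that a Frobenius cowreath with A <> 0 forces S to be bijective.
   Let e = id ⊗ ε : A ⊗ H -> A. The Casimir conditions give
   e(B(g ⊗ h)) = e(B(1 ⊗ S(g) h)),
   and together with the second Frobenius normalization also
   1 ⊗ h = t^1_0 e(B(t^2 h t^1_1 ⊗ t^3_1)) ⊗ t^3_2.
   Since S(t^2 h t^1_1) = S(t^1_1) S(h) S(t^2), the right-hand side depends on
   h only through S(h). Applying a linear form f on A with f(1) = 1 yields a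
   left inverse of S of finite rank, so H is finite-dimensional and S is
   bijective. *)

From HB Require Import structures.
Require Import Defs.
From mathcomp Require Import all_boot all_order all_algebra.
From mathcomp Require Import boolp.
From mathcomp Require classical_sets.

Set Implicit Arguments.
Unset Strict Implicit.
Unset Printing Implicit Defensive.

Import GRing.Theory.
Local Open Scope ring_scope.

(** * Linear algebra: separating linear forms and operators of finite rank *)

Lemma linear_packed (k : fieldType) (U V : lmodType k) (f : U -> V) :
  linear f -> exists g : {linear U -> V}, g =1 f.
Proof.
move=> lf; pose fL := GRing.isLinear.Build k U V *:%R f lf.
pose g : {linear U -> V} := HB.pack f fL.
by exists g.
Qed.

(** Zorn's lemma gives a subspace maximal among those avoiding [v]. By maximality [v] spans a
    complement of it, and [f] is the coordinate along [v]. *)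
Lemma ex_dual_vector (k : fieldType) (V : lmodType k) (v : V) : v != 0 ->
  exists f : {linear V -> k^o}, f v = 1.
Proof.
(* The empty set is [closed], which covers the union of the empty chain; [X0] then recovers 0 from
   maximality. *)
move=> v0; pose closed (X : V -> Prop) :=
  forall (c : k) x y, X x -> X y -> X (c *: x + y).
have [F Fclosed F_tot|X [[clX vX] maxX]] :=
  @classical_sets.Zorn_bigcup V (fun X => closed X /\ ~ X v).
  split=> [c x y [X FX Xx] [Y FY Yy]|[X FX]]; last by case: (Fclosed X FX).
  have [XY|YX] := F_tot X Y FX FY.
    by exists Y => //; apply: (Fclosed Y FY).1 => //; apply: XY.
  by exists X => //; apply: (Fclosed X FX).1 => //; apply: YX.
have XZ c x : X x -> X (c *: x).
  by move=> Xx; rewrite -[c](subrK 1) scalerDl scale1r; apply: clX.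
have XD x y : X x -> X y -> X (x + y).
  by move=> Xx Xy; rewrite -[x]scale1r; apply: clX.
have X0 : X 0.
  apply: contrapT => nX0; apply: (maxX (fun x => X x \/ x = 0)).
    by split=> [x|sub]; [left | apply/nX0/sub; right].
  split=> [c x y [Xx|->] [Xy|->]|[//|/eqP]]; last by rewrite (negPf v0).
  - by left; apply: clX.
  - by left; rewrite addr0; apply: XZ.
  - by left; rewrite scaler0 add0r.
  - by right; rewrite scaler0 add0r.
(* Otherwise X + k x is closed and strictly larger. If it contained v, then v - c x would lie in X
   with c nonzero, and dividing by c would decompose x. *)
have decomp x : exists c : k, X (x - c *: v).
  apply: contrapT => nx.
  apply: (maxX (fun y => exists c : k, X (y - c *: x))).
    split=> [y Xy|sub]; first by exists 0; rewrite scale0r subr0.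
    apply: nx; exists 0; rewrite scale0r subr0; apply: sub.
    by exists 1; rewrite scale1r subrr.
  split=> [c y z [a Xa] [b Xb]|[c Xc]].
    exists (c * a + b); rewrite scalerDl -scalerA opprD addrACA -scalerBr.
    exact: clX.
  have [c0|c0] := eqVneq c 0.
    by apply: vX; rewrite c0 scale0r subr0 in Xc.
  apply: nx; exists c^-1; have := XZ (- c^-1) _ Xc.
  by rewrite scalerBr !scaleNr scalerA mulVf // scale1r opprK addrC.
have decomp_uniq x a b : X (x - a *: v) -> X (x - b *: v) -> a = b.
  move=> Xa /(XZ (-1)); rewrite scaleN1r opprB => /(XD _ _ Xa).
  rewrite addrC subrKA -scalerBl => Xab; apply/eqP; rewrite eq_sym -subr_eq0.
  apply: contra_notT vX => /mulVf ab; rewrite -[v]scale1r -ab -scalerA.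
  exact: XZ.
pose f x : k^o := sval (cid (decomp x)).
have fP x : X (x - f x *: v) := svalP (cid (decomp x)).
have [|g gE] := @linear_packed k V k^o f.
  move=> c x y; apply: (decomp_uniq _ _ _ (fP _)).
  by rewrite scalerDl -scalerA opprD addrACA -scalerBr; apply: clX.
exists g; rewrite gE; apply: (decomp_uniq _ _ _ (fP _)).
by rewrite scale1r subrr.
Qed.

(** The list represents an element of V* ⊗ V; its forms and vectors later serve as maps to and from
    k^n. *)
Definition finite_rank (k : fieldType) (V : lmodType k) (g : V -> V) : Prop :=
  exists s : seq ({linear V -> k^o} * V),
    forall v, g v = \sum_(p <- s) p.1 v *: p.2.

(** The Sweedler sum is a finite sum over the chosen representative of [t], and the lists for its
    terms concatenate. *)
Lemma finite_rank_sweedler (k : fieldType) (U V W : lmodType k) (t : U ⊗ V)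
    (g : U -> V -> W -> W) :
  (forall x y, finite_rank (g x y)) ->
  finite_rank (fun v => \sw_(x ⊗ y <- t) g x y v).
Proof.
move=> rank_g; rewrite /sweedler; elim: (repr t) => [|p r [s sE]].
  by exists [::] => v; rewrite !big_nil.
have [s' s'E] := rank_g p.1 p.2; exists (s' ++ s) => v.
by rewrite big_cons big_cat sE s'E.
Qed.

Lemma finite_rank_scalel (k : fieldType) (V : lmodType k) (f : V -> k^o)
    (v : V) :
  linear f -> finite_rank (fun x => (f x : k) *: v).
Proof.
move=> lf; have [g gE] := linear_packed lf.
by exists [:: (g, v)] => x; rewrite big_seq1 gE.
Qed.

(** The composite of [c] and [e] is g f = id, so V embeds in k^n and is finite-dimensional; there an
    injective endomorphism is onto. The argument is run on the matrices of c e and c f e. *)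
Lemma surjective_of_finite_rank_retraction (k : fieldType) (V : lmodType k)
    (f : {linear V -> V}) (g : V -> V) :
  cancel f g -> finite_rank g -> forall v, exists w, v = f w.
Proof.
move=> fK [s gE] v; pose n := size s.
pose c (v : V) : 'rV[k]_n := \row_i (tnth (in_tuple s) i).1 (f v).
pose e (u : 'rV[k]_n) : V := \sum_i u 0 i *: (tnth (in_tuple s) i).2.
have cK w : e (c w) = w.
  rewrite -[RHS]fK gE big_tnth; apply: eq_bigr => i _.
  by rewrite mxE.
have lc : linear c.
  by move=> a x y; apply/rowP=> i; rewrite !mxE !linearP.
have le : linear e.
  move=> a x y; rewrite scaler_sumr -big_split; apply: eq_bigr => i _ /=.
  by rewrite !mxE scalerDl scalerA.
have [E EE] : exists E : {linear 'rV[k]_n -> 'rV[k]_n}, E =1 c \o e.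
  by apply: linear_packed => a x y; rewrite /= le lc.
have [M ME] : exists M : {linear 'rV[k]_n -> 'rV[k]_n}, M =1 c \o f \o e.
  by apply: linear_packed => a x y; rewrite /= le linearP lc.
have cinj := can_inj cK; have finj := can_inj fK.
have kerME : (kermx (lin1_mx M) <= kermx (lin1_mx E))%MS.
  apply/row_subP=> i; apply/sub_kermxP; rewrite mul_rV_lin1 EE /=.
  have /sub_kermxP : (row i (kermx (lin1_mx M)) <= kermx (lin1_mx M))%MS.
    exact: row_sub.
  rewrite mul_rV_lin1 ME /=.
  set u := row i _ => cfe0.
  have c0 : c 0 = 0 by apply/rowP=> j; rewrite !mxE !linear0.
  have: c (f (e u)) = c (f 0) by rewrite cfe0 linear0 c0.
  by move=> /cinj/finj ->.
have subME : (lin1_mx M <= lin1_mx E)%MS.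
  apply/row_subP=> i; rewrite rowE mul_rV_lin1 ME /= -[f _]cK.
  by rewrite -[c (e _)]EE -mul_rV_lin1 submxMl.
(* The kernel inclusion gives rank E <= rank M, which turns the inclusion of images (row spaces)
   into an equality. *)
have subEM : (lin1_mx E <= lin1_mx M)%MS.
  rewrite -(geq_leqif (mxrank_leqif_sup subME)).
  have := mxrankS kerME; rewrite !mxrank_ker.
  by move/leq_sub2l => /(_ n); rewrite !subKn // ?rank_leq_row.
have: (c v <= lin1_mx M)%MS.
  apply: submx_trans subEM.
  by rewrite -[v]cK -[c (e _)]EE -mul_rV_lin1 submxMl.
case/submxP=> D; rewrite mul_rV_lin1 ME /= => /cinj ->.
by exists (e D).
Qed.

(** * Linearity of Sweedler expressions *)

Section SweedlerCalculus.
Variable k : fieldType.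
Implicit Types U V W X : lmodType k.

Lemma linear_comp U V W (f : V -> W) (g : U -> V) :
  linear f -> linear g -> linear (fun x => f (g x)).
Proof. by move=> lf lg c x y; rewrite lg lf. Qed.

Lemma linear_mulr U (C : pzAlgType k) (f : U -> C) (z : C) :
  linear f -> linear (fun x => f x * z).
Proof. by move=> lf; exact: linear_comp (pz_mul_linearl z) lf. Qed.

Lemma linear_mull U (C : pzAlgType k) (f : U -> C) (z : C) :
  linear f -> linear (fun x => z * f x).
Proof. by move=> lf; exact: linear_comp (pz_mul_linearr z) lf. Qed.

Lemma linear_tensl U V W (f : U -> V) (w : W) :
  linear f -> linear (fun x => f x ⊗ w).
Proof. by move=> lf; exact: linear_comp (@tens_linearl _ _ _ w) lf. Qed.

Lemma linear_tensr U V W (f : U -> W) (v : V) :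
  linear f -> linear (fun x => v ⊗ f x).
Proof. by move=> lf; exact: linear_comp (@tens_linearr _ _ _ v) lf. Qed.

Lemma linear_scale U V (a : k) (f : U -> V) :
  linear f -> linear (fun x => a *: f x).
Proof.
by move=> lf c x y; rewrite lf scalerDr !scalerA [c * a]mulrC.
Qed.

Lemma linear_scalel U V (f : U -> k^o) (v : V) :
  linear f -> linear (fun x => (f x : k) *: v).
Proof. by move=> lf c x y; rewrite lf scalerDl -scalerA. Qed.

Lemma linear_counit U (H : hopfAlgType k) (f : U -> H) :
  linear f -> linear (fun x => counit (f x) : k^o).
Proof. by move=> lf c x y; rewrite lf linearP. Qed.

Lemma linear_sweedler U V W X (t : V ⊗ W) (f : U -> V -> W -> X) :
  (forall v w, linear (fun x => f x v w)) ->
  linear (fun x => sweedler t (f x)).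
Proof.
move=> lf c x y; rewrite /sweedler scaler_sumr -big_split.
by apply: eq_bigr => p _; rewrite lf.
Qed.

Lemma linear_sweedler_arg U V W X (t : U -> V ⊗ W) (f : V -> W -> X) :
  is_bilinear f -> linear t -> linear (fun x => sweedler (t x) f).
Proof. by move=> bf lt; exact: linear_comp (sweedler_linear bf) lt. Qed.

End SweedlerCalculus.

(** Replacing a tensor by a decomposition is sound only under a multilinear body, so most rewritings
    below leave linearity goals. They are solved by recursion on the shape of the body, with
    hypotheses and packed linear maps as leaves. *)
Ltac lin :=
  lazymatch goal with
  | |- is_bilinear _ => split=> ? /=; lin
  | |- GRing.linear_for _ (fun x => x) => by []
  | |- GRing.linear_for _ (fun x => tens _ _) =>
      first [apply: linear_tensl | apply: linear_tensr]; lin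
  | |- GRing.linear_for _ (fun x => _ * _) =>
      first [apply: linear_mull | apply: linear_mulr]; lin
  | |- GRing.linear_for _ (fun x => _ *: _) =>
      first [apply: linear_scale | apply: linear_scalel]; lin
  | |- GRing.linear_for _ (fun x => sweedler _ _) =>
      first [apply: linear_sweedler => ? ? /= | apply: linear_sweedler_arg]; lin
  | |- GRing.linear_for _ (fun x => ?g (@?f x)) =>
      first [lin_atom | apply: linear_counit; lin
            | apply: (linear_comp (f := g)); [lin_atom | lin]]
  | |- forall _, _ => move=> ?; lin
  | |- _ => lin_atom
  end
with lin_atom := first [assumption | exact: linearP
  | exact: pz_mul_linearr | exact: tens_linearr
  | match goal with lH : _ |- _ => solve [apply: lH] end].

(** * Exchange, linear images and nesting of Sweedler sums *)

Section SweedlerTheory.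
Variable k : fieldType.
Implicit Types U V W X Y : lmodType k.

Lemma eq_sweedler V W X (t : V ⊗ W) (f g : V -> W -> X) :
  (forall x y, f x y = g x y) -> sweedler t f = sweedler t g.
Proof. by move=> fg; apply: eq_bigr => p _. Qed.

Lemma sweedlerC U V W X Y (s : U ⊗ V) (t : W ⊗ X) (f : U -> V -> W -> X -> Y) :
  \sw_(x ⊗ y <- s) \sw_(z ⊗ w <- t) f x y z w =
  \sw_(z ⊗ w <- t) \sw_(x ⊗ y <- s) f x y z w.
Proof. exact: exchange_big. Qed.

Lemma linear_sum_sweedler U V W X (t : V ⊗ W) (f : V -> W -> U) (g : U -> X) :
  linear g -> g (sweedler t f) = \sw_(x ⊗ y <- t) g (f x y).
Proof.
move=> lg; have [g' gE] := linear_packed lg.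
by rewrite -gE /sweedler linear_sum; apply: eq_bigr => p _; rewrite gE.
Qed.

Lemma sweedler_sweedler U V W X Y (t : U ⊗ V) (f : U -> V -> W ⊗ X)
    (g : W -> X -> (Y : lmodType k)) : is_bilinear g ->
  sweedler (sweedler t f) g = \sw_(x ⊗ y <- t) sweedler (f x y) g.
Proof. by move/sweedler_linear/linear_sum_sweedler->. Qed.

Lemma tensZl V W (c : k) (v : V) (w : W) : (c *: v) ⊗ w = c *: (v ⊗ w).
Proof. by apply: (@bilinZl _ _ _ _ tens); lin. Qed.

Lemma sweedler_tens3 U V W X (f : U -> V -> W -> X) (s : U ⊗ V) (w : W) :
  (forall y z, linear (fun x => f x y z)) ->
  (forall x z, linear (fun y => f x y z)) ->
  (forall x y, linear (fun z => f x y z)) ->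
  \sw_(x ⊗ y ⊗ z <- s ⊗ w) f x y z = \sw_(x ⊗ y <- s) f x y w.
Proof. by move=> l1 l2 l3; apply: sweedlerE; lin. Qed.

End SweedlerTheory.

(** * The Hopf algebra axioms under a multilinear body *)

Section HopfTheory.
Variables (k : fieldType) (H : hopfAlgType k).
Implicit Types (U : lmodType k) (g h x y : H).

(** The trilinear [f] induces a linear map [F] on H ⊗ H ⊗ H, and [F] is applied to both sides of
    coassociativity. *)
Lemma sw_comulA U (f : H -> H -> H -> U) h :
  (forall y z, linear (fun x => f x y z)) ->
  (forall x z, linear (fun y => f x y z)) ->
  (forall x y, linear (fun z => f x y z)) ->
  \sw_(h' ⊗ h3 <- comul h) \sw_(h1 ⊗ h2 <- comul h') f h1 h2 h3 =
  \sw_(h1 ⊗ h' <- comul h) \sw_(h2 ⊗ h3 <- comul h') f h1 h2 h3.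
Proof.
move=> l1 l2 l3; pose F t := \sw_(x ⊗ y ⊗ z <- t) f x y z.
have lF : linear F by apply: sweedler_linear; lin.
have := congr1 F (comulA h); rewrite !(linear_sum_sweedler _ _ lF) => E.
have FE s w : F (s ⊗ w) = \sw_(x ⊗ y <- s) f x y w by apply: sweedler_tens3.
transitivity (\sw_(h1 ⊗ h2 <- comul h) F (comul h1 ⊗ h2)).
  by apply: eq_sweedler => h1 h2; rewrite FE.
rewrite E; apply: eq_sweedler => h1 h2; rewrite (linear_sum_sweedler _ _ lF).
by apply: eq_sweedler => h3 h4; rewrite FE sweedlerE; last lin.
Qed.

Lemma sw_comul3 U (f : H -> H -> H -> U) h :
  (forall y z, linear (fun x => f x y z)) ->
  (forall x z, linear (fun y => f x y z)) ->
  (forall x y, linear (fun z => f x y z)) ->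
  \sw_(h1 ⊗ h2 ⊗ h3 <- comul3 h) f h1 h2 h3 =
  \sw_(h' ⊗ h3 <- comul h) \sw_(h1 ⊗ h2 <- comul h') f h1 h2 h3.
Proof.
move=> l1 l2 l3; rewrite sweedler_sweedler; last by lin.
by apply: eq_sweedler => x y; rewrite sweedler_tens3.
Qed.

Lemma sw_counitl U (f : H -> U) h : linear f ->
  \sw_(h1 ⊗ h2 <- comul h) counit h1 *: f h2 = f h.
Proof.
move=> lf; have [f' fE] := linear_packed lf.
rewrite -[in RHS](counitl h) linear_sum_sweedler //.
by apply: eq_sweedler => x y; rewrite -!fE linearZ.
Qed.

Lemma sw_counitr U (f : H -> U) h : linear f ->
  \sw_(h1 ⊗ h2 <- comul h) counit h2 *: f h1 = f h.
Proof.
move=> lf; have [f' fE] := linear_packed lf.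
rewrite -[in RHS](counitr h) linear_sum_sweedler //.
by apply: eq_sweedler => x y; rewrite -!fE linearZ.
Qed.

Lemma sw_antipodel U (f : H -> U) h : linear f ->
  \sw_(h1 ⊗ h2 <- comul h) f (antipode h1 * h2) = counit h *: f 1.
Proof.
move=> lf; rewrite -linear_sum_sweedler // antipodel.
by have [f' fE] := linear_packed lf; rewrite -!fE linearZ.
Qed.

Lemma sw_antipoder U (f : H -> U) h : linear f ->
  \sw_(h1 ⊗ h2 <- comul h) f (h1 * antipode h2) = counit h *: f 1.
Proof.
move=> lf; rewrite -linear_sum_sweedler // antipoder.
by have [f' fE] := linear_packed lf; rewrite -!fE linearZ.
Qed.

Lemma sw_tensM (C D : pzAlgType k) U (s t : C ⊗ D) (f : C -> D -> U) :
  is_bilinear f ->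
  sweedler (s * t) f =
  \sw_(x ⊗ y <- s) \sw_(x' ⊗ y' <- t) f (x * x') (y * y').
Proof.
move=> [fl fr]; rewrite sweedler_sweedler //; apply: eq_sweedler => x y.
rewrite sweedler_sweedler //; apply: eq_sweedler => x' y'.
exact: sweedlerE.
Qed.

Lemma sw_comulM U (f : H -> H -> U) g h : is_bilinear f ->
  sweedler (comul (g * h)) f =
  \sw_(g1 ⊗ g2 <- comul g) \sw_(h1 ⊗ h2 <- comul h) f (g1 * h1) (g2 * h2).
Proof. by move=> lf; rewrite comul_monoid.2 sw_tensM. Qed.

Lemma sw_comul1 U (f : H -> H -> U) : is_bilinear f ->
  sweedler (comul 1) f = f 1 1.
Proof. by move=> lf; rewrite comul_monoid.1 sweedlerE. Qed.

Lemma counitM g h : counit (g * h) = counit g * counit h.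
Proof. exact: counit_monoid.2. Qed.

Lemma counit1 : counit (1 : H) = 1.
Proof. exact: counit_monoid.1. Qed.

End HopfTheory.

(** * The comodule algebra axioms under a multilinear body *)

Section ComoduleTheory.
Variables (k : fieldType) (H : hopfAlgType k) (A : comodAlgType H).
Implicit Types (U : lmodType k) (a b : A).

Lemma sw_coactA U (f : A -> H -> H -> U) a :
  (forall y z, linear (fun x => f x y z)) ->
  (forall x z, linear (fun y => f x y z)) ->
  (forall x y, linear (fun z => f x y z)) ->
  \sw_(a' ⊗ a2 <- coact a) \sw_(a0 ⊗ a1 <- coact a') f a0 a1 a2 =
  \sw_(a0 ⊗ a' <- coact a) \sw_(a1 ⊗ a2 <- comul a') f a0 a1 a2.
Proof.
move=> l1 l2 l3; pose F t := \sw_(x ⊗ y ⊗ z <- t) f x y z.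
have lF : linear F by apply: sweedler_linear; lin.
have := congr1 F (coactA a); rewrite !(linear_sum_sweedler _ _ lF) => E.
have FE s w : F (s ⊗ w) = \sw_(x ⊗ y <- s) f x y w by apply: sweedler_tens3.
transitivity (\sw_(a0 ⊗ a1 <- coact a) F (coact a0 ⊗ a1)).
  by apply: eq_sweedler => a0 a1; rewrite FE.
rewrite E; apply: eq_sweedler => a0 a'; rewrite (linear_sum_sweedler _ _ lF).
by apply: eq_sweedler => a1 a2; rewrite FE sweedlerE; last lin.
Qed.

(** Coassociativity is built in here, so that [a1] and [a2] come from one comultiplication and can
    be contracted by antipode identities. *)
Lemma sw_coact3 U (f : A -> H -> H -> U) a :
  (forall y z, linear (fun x => f x y z)) ->
  (forall x z, linear (fun y => f x y z)) ->
  (forall x y, linear (fun z => f x y z)) ->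
  \sw_(a0 ⊗ a1 ⊗ a2 <- coact3 a) f a0 a1 a2 =
  \sw_(a0 ⊗ a' <- coact a) \sw_(a1 ⊗ a2 <- comul a') f a0 a1 a2.
Proof.
move=> l1 l2 l3; rewrite sweedler_sweedler; last by lin.
rewrite -sw_coactA //.
by apply: eq_sweedler => x y; rewrite sweedler_tens3.
Qed.

Lemma sw_coact_counit U (f : A -> U) a : linear f ->
  \sw_(a0 ⊗ a1 <- coact a) counit a1 *: f a0 = f a.
Proof.
move=> lf; have [f' fE] := linear_packed lf.
rewrite -[in RHS](coact_counit a) linear_sum_sweedler //.
by apply: eq_sweedler => x y; rewrite -!fE linearZ.
Qed.

Lemma sw_coactM U (f : A -> H -> U) a b : is_bilinear f ->
  sweedler (coact (a * b)) f =
  \sw_(a0 ⊗ a1 <- coact a) \sw_(b0 ⊗ b1 <- coact b) f (a0 * b0) (a1 * b1).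
Proof. by move=> lf; rewrite coact_monoid.2 sw_tensM. Qed.

Lemma sw_coact1 U (f : A -> H -> U) : is_bilinear f ->
  sweedler (coact 1) f = f 1 1.
Proof. by move=> lf; rewrite coact_monoid.1 sweedlerE. Qed.

End ComoduleTheory.

(** * The antipode reverses products and coproducts *)

Section Antipode.
Variables (k : fieldType) (H : hopfAlgType k).
Implicit Types (C : pzAlgType k) (g h x y : H).

Lemma scale_mull C (c : k) (u v : C) : (c *: u) * v = c *: (u * v).
Proof. by rewrite [RHS]pzalg_scaleAl. Qed.

Lemma scale_mulr C (c : k) (u v : C) : u * (c *: v) = c *: (u * v).
Proof. by rewrite [RHS]pzalg_scaleAr. Qed.

(** In the convolution algebra of maps H -> C, L = L (M R) = (L M) R = R. *)
Lemma convolution_inverse_unique C (L M R : H -> C) :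
  linear L -> linear M -> linear R ->
  (forall h, \sw_(h1 ⊗ h2 <- comul h) L h1 * M h2 = counit h *: (1 : C)) ->
  (forall h, \sw_(h1 ⊗ h2 <- comul h) M h1 * R h2 = counit h *: (1 : C)) ->
  L =1 R.
Proof.
move=> lL lM lR LM MR h.
rewrite -(sw_counitr h lL) -[RHS](sw_counitl h lR).
transitivity (\sw_(h1 ⊗ h' <- comul h) \sw_(h2 ⊗ h3 <- comul h')
   L h1 * M h2 * R h3).
  apply: eq_sweedler => h1 h'.
  under [RHS]eq_sweedler do rewrite -mulrA.
  rewrite -(linear_sum_sweedler _ _ (pz_mul_linearr (L h1))) MR.
  by rewrite scale_mulr mulr1.
rewrite -(@sw_comulA _ _ _ (fun a b c => L a * M b * R c)); [|by lin..].
apply: eq_sweedler => h' h3.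
by rewrite -(linear_sum_sweedler _ _ (pz_mul_linearl (R h3))) LM
  scale_mull mul1r.
Qed.

Lemma antipode1 : antipode (1 : H) = 1.
Proof.
have := antipodel (1 : H); rewrite sw_comul1; last by lin.
by rewrite mulr1 counit1 scale1r.
Qed.

(** The sum of S(h1) S(g1) g2 h2 S(g3 h3) is evaluated twice. Contracting S(g1) g2 and then S(h1) h2
    leaves S(g h); contracting g2 h2 S(g3 h3) leaves S(h) S(g). *)
Lemma antipodeM g h : antipode (g * h) = antipode h * antipode g.
Proof.
pose F h1 g1 g2 h2 g3 h3 : H :=
  antipode h1 * (antipode g1 * g2) * h2 * antipode (g3 * h3).
transitivity (\sw_(g' ⊗ g3 <- comul g) \sw_(g1 ⊗ g2 <- comul g')
  \sw_(h' ⊗ h3 <- comul h) \sw_(h1 ⊗ h2 <- comul h') F h1 g1 g2 h2 g3 h3).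
  rewrite -[LHS](@sw_counitl _ _ _ (fun x => antipode (x * h))); last by lin.
  apply: eq_sweedler => g' g3.
  rewrite -(@sw_counitl _ _ _ (fun x => counit g' *: antipode (g3 * x)) h);
    last by lin.
  rewrite sweedlerC; apply: eq_sweedler => h' h3; rewrite sweedlerC.
  symmetry.
  transitivity (\sw_(h1 ⊗ h2 <- comul h')
      antipode h1 * h2 * (counit g' *: antipode (g3 * h3))).
    apply: eq_sweedler => h1 h2.
    rewrite (@sw_antipodel _ _ _
      (fun x => antipode h1 * x * h2 * antipode (g3 * h3)));
      last by lin.
    by rewrite mulr1 scale_mulr.
  rewrite (@sw_antipodel _ _ _
    (fun x => x * (counit g' *: antipode (g3 * h3))));
    last by lin.
  by rewrite mul1r.
rewrite sw_comulA; try by rewrite /F; lin.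
rewrite -[RHS](@sw_counitr _ _ _ (fun x => antipode h * antipode x));
  last by lin.
apply: eq_sweedler => g1 g'.
rewrite -[antipode h * _](@sw_counitr _ _ _
  (fun x => antipode x * antipode g1));
  last by lin.
have lZ : linear ( *:%R (counit g') : H -> H) by lin.
rewrite (linear_sum_sweedler _ _ lZ).
under eq_sweedler do (rewrite sw_comulA; try by rewrite /F; lin).
rewrite sweedlerC; apply: eq_sweedler => h1 h'; rewrite sweedlerC.
(* Since [comul] is multiplicative, g2 h2 and g3 h3 are the two legs of the coproduct of g' h', so
   the antipode axiom applies to g' h'. *)
transitivity (\sw_(x ⊗ y <- comul (g' * h'))
  antipode h1 * antipode g1 * (x * antipode y)).
  rewrite sw_comulM; last by lin.
  rewrite sweedlerC; apply: eq_sweedler => h2 h3.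
  by apply: eq_sweedler => g2 g3; rewrite /F !mulrA.
rewrite (@sw_antipoder _ _ _ (fun x => antipode h1 * antipode g1 * x));
  last by lin.
by rewrite mulr1 counitM scalerA.
Qed.

(** Both sides are convolution inverses of [comul] among maps H -> H ⊗ H, the left one because
    [comul] is an algebra map. *)
Lemma comul_antipode h :
  comul (antipode h) = \sw_(h1 ⊗ h2 <- comul h) antipode h2 ⊗ antipode h1.
Proof.
move: h; apply: (@convolution_inverse_unique (H ⊗ H)%type _ comul); try by lin.
  move=> h /=; under eq_sweedler do rewrite -comul_monoid.2.
  rewrite sw_antipodel; last by lin.
  by rewrite comul_monoid.1.
(* For the right-hand side the inner pair h2 S(h3) contracts first, and then h1 S(h4). *)
move=> h; pose F h1 h2 h3 h4 : H ⊗ H := (h1 * antipode h4) ⊗ (h2 * antipode h3).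
transitivity (\sw_(h1 ⊗ h' <- comul h) \sw_(h'' ⊗ h4 <- comul h')
   \sw_(h2 ⊗ h3 <- comul h'') F h1 h2 h3 h4).
  transitivity (\sw_(h' ⊗ h'' <- comul h) \sw_(h1 ⊗ h2 <- comul h')
     \sw_(h3 ⊗ h4 <- comul h'') F h1 h2 h3 h4).
    apply: eq_sweedler => h' h'' /=.
    rewrite -[comul h']sweedler_tens.
    rewrite [_ * _](linear_sum_sweedler _ _ (pz_mul_linearl _)).
    rewrite sweedler_tens; apply: eq_sweedler => h1 h2.
    rewrite (linear_sum_sweedler _ _ (pz_mul_linearr _)).
    by apply: eq_sweedler => h3 h4; rewrite tensM.
  rewrite sw_comulA; try by rewrite /F; lin.
  apply: eq_sweedler => h1 h'; rewrite sw_comulA //; by rewrite /F; lin.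
transitivity (\sw_(h1 ⊗ h' <- comul h) \sw_(h'' ⊗ h4 <- comul h')
   counit h'' *: ((h1 * antipode h4) ⊗ (1 : H))).
  apply: eq_sweedler => h1 h'; apply: eq_sweedler => h'' h4.
  by rewrite (@sw_antipoder _ _ _ (fun x => (h1 * antipode h4) ⊗ x)); last lin.
under eq_sweedler => h1 h'.
  rewrite (@sw_counitl _ _ _ (fun x => (h1 * antipode x) ⊗ (1 : H)));
    last by lin.
  over.
by rewrite (@sw_antipoder _ _ _ (fun x => x ⊗ (1 : H))); last lin.
Qed.

End Antipode.

(** * A bijective antipode yields h-separability *)

Section InverseAntipode.
Variables (k : fieldType) (H : hopfAlgType k) (T : {linear H -> H}).
Hypotheses (antipodeK : cancel antipode T) (antipodeVK : cancel T antipode).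
Implicit Types (U : lmodType k) (g h x y : H).

Lemma antipodeVM g h : T (g * h) = T h * T g.
Proof. by apply: (can_inj antipodeK); rewrite antipodeM !antipodeVK. Qed.

Lemma antipodeV1 : T 1 = 1.
Proof. by rewrite -[X in T X](antipode1 H) antipodeK. Qed.

Lemma comul_antipodeV h : comul (T h) = \sw_(h1 ⊗ h2 <- comul h) T h2 ⊗ T h1.
Proof.
rewrite -{2}[h]antipodeVK comul_antipode sweedler_sweedler; last by lin.
rewrite -[LHS]sweedler_tens; apply: eq_sweedler => x y.
by rewrite sweedlerE ?antipodeK; last lin.
Qed.

(** Applying [T], the inverse of the antipode, to S(h1) h2 reverses the factors and gives T(h2)
    h1. *)
Lemma sw_antipodeVl U (f : H -> U) h : linear f ->
  \sw_(h1 ⊗ h2 <- comul h) f (T h2 * h1) = counit h *: f 1.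
Proof.
move=> lf; rewrite -[X in f X]antipodeV1.
rewrite -(@sw_antipodel _ _ _ (fun x => f (T x))); last by lin.
by apply: eq_sweedler => h1 h2; rewrite antipodeVM antipodeK.
Qed.

Lemma sw_antipodeVr U (f : H -> U) h : linear f ->
  \sw_(h1 ⊗ h2 <- comul h) f (h2 * T h1) = counit h *: f 1.
Proof.
move=> lf; rewrite -[X in f X]antipodeV1.
rewrite -(@sw_antipoder _ _ _ (fun x => f (T x))); last by lin.
by apply: eq_sweedler => h1 h2; rewrite antipodeVM antipodeK.
Qed.

Variables (A : comodAlgType H) (B : {linear (H ⊗ H)%type -> (A ⊗ H)%type}).
Hypothesis BE : forall h h', B (h ⊗ h') = 1 ⊗ (h' * T h).

(** In the first identity T(g2) meets g1 and a2 meets T(a1), so both pairs contract to counits. In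
    the second, the coproduct of T(h2) places T(h3) next to h1. *)
Lemma antipodeV_Casimir : Casimir B.
Proof.
split=> [a g h h'|h h'].
  pose F a0 a1 a2 g1 g2 g3 : A ⊗ H :=
    a0 ⊗ (g3 * h' * (a2 * T a1) * T h * (T g2 * g1)).
  rewrite sw_coact3; try by lin.
  transitivity (\sw_(a0 ⊗ a' <- coact a) \sw_(a1 ⊗ a2 <- comul a')
    a0 ⊗ (g * h' * (a2 * T a1) * T h)).
    apply: eq_sweedler => a0 a'; apply: eq_sweedler => a1 a2.
    rewrite sw_comul3; try by lin.
    rewrite -[RHS](@sw_counitl _ _ _
      (fun x => a0 ⊗ (x * h' * (a2 * T a1) * T h))); last by lin.
    apply: eq_sweedler => g' g3.
    transitivity (\sw_(g1 ⊗ g2 <- comul g') F a0 a1 a2 g1 g2 g3).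
      apply: eq_sweedler => g1 g2.
      by rewrite BE !tensM !mul1r !mulr1 /F !antipodeVM !mulrA.
    rewrite (@sw_antipodeVl _
      (fun x => a0 ⊗ (g3 * h' * (a2 * T a1) * T h * x))); last by lin.
    by rewrite mulr1.
  rewrite BE !tensM !mul1r !mulr1.
  rewrite -[RHS](@sw_coact_counit _ _ A _ (fun x : A => x ⊗ (g * (h' * T h))));
    last by lin.
  apply: eq_sweedler => a0 a'.
  rewrite (@sw_antipodeVr _ (fun x => a0 ⊗ (g * h' * x * T h))); last by lin.
  by rewrite mulr1 mulrA.
transitivity (\sw_(h1 ⊗ h2 <- comul h) \sw_(h'1 ⊗ h'2 <- comul h')
  \sw_(h3 ⊗ h4 <- comul h2) (1 : A) ⊗ (h'1 * T h4) ⊗ (h'2 * (T h3 * h1))).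
  apply: eq_sweedler => h1 h2; rewrite BE sweedlerE; last by lin.
  rewrite sw_coact1; last by lin.
  rewrite sw_comulM; last by lin.
  apply: eq_sweedler => h'1 h'2; rewrite comul_antipodeV.
  rewrite sweedler_sweedler; last by lin.
  apply: eq_sweedler => h3 h4; rewrite sweedlerE; last by lin.
  by rewrite mulr1 mulrA.
rewrite sweedlerC; apply: eq_sweedler => h'1 h'2; rewrite BE.
(* Coassociativity puts h1 and h3 into the same comultiplication, so that T(h3) h1 contracts. *)
rewrite -(@sw_comulA _ _ _ (fun h1 h3 h4 =>
  (1 : A) ⊗ (h'1 * T h4) ⊗ (h'2 * (T h3 * h1)))); try by lin.
rewrite -[RHS](@sw_counitl _ _ _
  (fun x => (1 : A) ⊗ (h'1 * T x) ⊗ h'2)); last by lin.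
apply: eq_sweedler => x h4.
rewrite (@sw_antipodeVl _ (fun y => (1 : A) ⊗ (h'1 * T h4) ⊗ (h'2 * y)));
  last by lin.
by rewrite mulr1.
Qed.

Lemma antipodeV_normalized : normalized B.
Proof.
move=> h; under eq_sweedler do rewrite BE.
by rewrite (@sw_antipodeVr _ (fun x => (1 : A) ⊗ x)); last lin.
Qed.

(** With h1, h2 the legs of h', the H-component of the product is h'' T(h2) h1 T(h), whose middle
    contracts to ε(h'). *)
Lemma antipodeV_h_separable : h_separable H A.
Proof.
exists B; split; [exact: antipodeV_Casimir | exact: antipodeV_normalized |].
move=> h h' h''; rewrite BE.
transitivity (\sw_(h1 ⊗ h2 <- comul h') (1 : A) ⊗ (h'' * (T h2 * h1) * T h)).
  apply: eq_sweedler => h1 h2; rewrite !BE.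
  rewrite sweedlerE; last by lin.
  by rewrite sweedlerE ?mul1r ?mulrA; last lin.
rewrite (@sw_antipodeVl _ (fun x => (1 : A) ⊗ (h'' * x * T h))); last by lin.
by rewrite mulr1.
Qed.

End InverseAntipode.

Lemma h_separable_of_bijective_antipode (k : fieldType) (H : hopfAlgType k)
    (A : comodAlgType H) :
  bijective (antipode : H -> H) -> h_separable H A.
Proof.
case=> f fK Kf.
have [|T TE] := @linear_packed k H H f.
  by move=> c x y; apply: (can_inj fK); rewrite linearP !Kf.
have antipodeK : cancel antipode T by move=> h; rewrite TE.
have antipodeVK : cancel T antipode by move=> h; rewrite TE.
have bilB : is_bilinear (fun h h' : H => (1 : A) ⊗ (h' * T h)) by lin.
have [B BE] := linear_packed (sweedler_linear bilB).
by apply: (antipodeV_h_separable antipodeK antipodeVK (B := B)) => h h';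
  rewrite BE sweedlerE.
Qed.

(** * Casimir morphisms after applying the counit, and recovery of h *)

Section FrobeniusAntipode.
Variables (k : fieldType) (H : hopfAlgType k) (A : comodAlgType H).
Implicit Types (a b : A) (g h x y : H) (u : (A ⊗ H)%type).

Definition tens_counit u : A := \sw_(a ⊗ h <- u) counit h *: a.

Lemma tens_counit_linear : linear tens_counit.
Proof. by apply: sweedler_linear; lin. Qed.

Lemma tens_counitE a h : tens_counit (a ⊗ h) = counit h *: a.
Proof. by apply: sweedlerE; lin. Qed.

(** As ε is an algebra map, so is id ⊗ ε; factors 1 ⊗ g therefore leave products as scalars ε(g). *)
Lemma tens_counitM u v : tens_counit (u * v) = tens_counit u * tens_counit v.
Proof.
rewrite /tens_counit sw_tensM; last by lin.
rewrite (linear_sum_sweedler _ _ (pz_mul_linearl _)).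
apply: eq_sweedler => a h.
rewrite (linear_sum_sweedler _ _ (pz_mul_linearr _)).
apply: eq_sweedler => b g.
by rewrite counitM scale_mull scale_mulr scalerA.
Qed.

Variable B : {linear (H ⊗ H)%type -> (A ⊗ H)%type}.
Hypothesis casB : Casimir B.

Local Notation e := tens_counit.
Let le : linear e := tens_counit_linear.

(** The sum of e(B(g1 ⊗ g2 S(g3) h)) is computed twice: g2 S(g3) contracts to give the left side,
    and [cas1] on g1, g2 gives the right side. *)
Lemma Casimir_counit g h :
  tens_counit (B (g ⊗ h)) = tens_counit (B (1 ⊗ (antipode g * h))).
Proof.
(* This is [e] applied to the first Casimir identity at a = 1 and h = 1. *)
have cas1 x y :
    \sw_(x1 ⊗ x2 <- comul x) e (B (x1 ⊗ (x2 * y))) = counit x *: e (B (1 ⊗ y)).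
  have := congr1 e (casB.1 1 x 1 y).
  rewrite !mulr1 tens_counitM tens_counitE scale_mull mul1r => <-.
  rewrite sw_coact3; try by lin.
  rewrite sw_coact1; last by lin.
  rewrite sw_comul1; last by lin.
  rewrite sw_comul3; try by lin.
  rewrite (linear_sum_sweedler _ _ le).
  apply: eq_sweedler => x' x3; rewrite (linear_sum_sweedler _ _ le).
  rewrite -[LHS](@sw_counitl _ _ _ (fun z : H => e (B (z ⊗ (x3 * y)))));
    last by lin.
  apply: eq_sweedler => x1 x2; rewrite !mulr1.
  by rewrite !tens_counitM !tens_counitE
    counit1 scale1r mul1r scale_mulr mulr1.
transitivity (\sw_(g' ⊗ g3 <- comul g) \sw_(g1 ⊗ g2 <- comul g')
  e (B (g1 ⊗ (g2 * (antipode g3 * h))))).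
  rewrite sw_comulA; try by lin.
  rewrite -[LHS](@sw_counitr _ _ _ (fun z : H => e (B (z ⊗ h)))); last by lin.
  apply: eq_sweedler => g1 g'.
  under [RHS]eq_sweedler do rewrite mulrA.
  rewrite (@sw_antipoder _ _ _ (fun z : H => e (B (g1 ⊗ (z * h)))));
    last by lin.
  by rewrite mul1r.
rewrite -[RHS](@sw_counitl _ _ _ (fun z : H => e (B (1 ⊗ (antipode z * h)))));
  last by lin.
by apply: eq_sweedler => g' g3; rewrite cas1.
Qed.

(** This is e ⊗ id applied to the second Casimir identity: the counit absorbs l1, and l2 becomes
    l. *)
Lemma Casimir_counit_colinear h h' :
  \sw_(h'1 ⊗ h'2 <- comul h') e (B (h ⊗ h'1)) ⊗ h'2 =
  \sw_(h1 ⊗ h2 <- comul h) \sw_(b ⊗ l <- B (h2 ⊗ h'))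
    \sw_(b0 ⊗ b1 <- coact b) b0 ⊗ (l * h1 * b1).
Proof.
pose F (t : (A ⊗ H ⊗ H)%type) : A ⊗ H := \sw_(u ⊗ z <- t) e u ⊗ z.
have bF : is_bilinear (fun (u : (A ⊗ H)%type) (z : H) => e u ⊗ z) by lin.
have lF : linear F := sweedler_linear bF.
have FE u z : F (u ⊗ z) = e u ⊗ z := sweedlerE bF u z.
have := congr1 F (casB.2 h h'); rewrite !(linear_sum_sweedler _ _ lF).
under [RHS]eq_sweedler do rewrite FE.
move<-; apply: eq_sweedler => h1 h2; rewrite (linear_sum_sweedler _ _ lF).
apply: eq_sweedler => b l; rewrite (linear_sum_sweedler _ _ lF).
apply: eq_sweedler => b0 b1; rewrite (linear_sum_sweedler _ _ lF).
under [LHS]eq_sweedler do rewrite FE tens_counitE tensZl.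
by rewrite (@sw_counitl _ _ _ (fun z => b0 ⊗ (z * h1 * b1))); last lin.
Qed.

Variable t : (A ⊗ H ⊗ H)%type.
Hypothesis tB : forall h,
  \sw_(t1 ⊗ t2 ⊗ t3 <- t)
    \sw_(x0 ⊗ x1 <- coact t1) \sw_(y1 ⊗ y2 <- comul t2)
      (x0 ⊗ 1) * B ((y2 * h * x1) ⊗ t3) * (1 ⊗ y1) =
  counit h *: ((1 : A) ⊗ (1 : H)).

(** A dual basis formula: h is a combination of finitely many fixed elements [z2], with coefficients
    in A depending linearly on h. *)
Lemma Frobenius_dual_basis h :
  \sw_(t1 ⊗ t2 ⊗ t3 <- t) \sw_(x0 ⊗ x1 <- coact t1) \sw_(z1 ⊗ z2 <- comul t3)
    (x0 * e (B ((t2 * h * x1) ⊗ z1))) ⊗ z2 = 1 ⊗ h.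
Proof.
(* [G] names the right side of [Casimir_counit_colinear] as an operator, so that it can be applied
   to the normalization [tB]. *)
pose G g u := \sw_(b ⊗ l <- u) \sw_(b0 ⊗ b1 <- coact b) b0 ⊗ (l * g * b1).
have lG g : linear (G g) by apply: sweedler_linear; lin.
have GM (x0 : A) u y1 g : G g ((x0 ⊗ 1) * u * (1 ⊗ y1)) =
    \sw_(b ⊗ l <- u) \sw_(x00 ⊗ x01 <- coact x0) \sw_(b0 ⊗ b1 <- coact b)
      (x00 * b0) ⊗ (l * (y1 * g * x01) * b1).
  rewrite /G sw_tensM; last by lin.
  rewrite sw_tensM; last by lin.
  rewrite sweedlerE; last by lin.
  apply: eq_sweedler => b l; rewrite sweedlerE; last by lin.
  rewrite mulr1 mul1r sw_coactM; last by lin.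
  apply: eq_sweedler => x00 x01; apply: eq_sweedler => b0 b1.
  by rewrite !mulrA.
(* Since G h1 sends 1 ⊗ 1 to 1 ⊗ h1, the element 1 ⊗ h is the sum of ε(h2) G h1 (1 ⊗ 1), and [tB] at
   h2 expands ε(h2) 1 ⊗ 1. *)
transitivity (\sw_(h1 ⊗ h2 <- comul h)
  G h1 (counit h2 *: ((1 : A) ⊗ (1 : H)))); last first.
  rewrite -[RHS](@sw_counitr _ _ _ (fun z => (1 : A) ⊗ z)); last by lin.
  apply: eq_sweedler => h1 h2.
  have [G' GE] := linear_packed (lG h1); rewrite -GE linearZ /= GE.
  rewrite /G sweedlerE; last by lin.
  by rewrite sw_coact1 ?mul1r ?mulr1; last lin.
under [RHS]eq_sweedler => h1 h2.
  rewrite -tB (linear_sum_sweedler _ _ (lG h1)).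
  over.
rewrite [RHS]sweedlerC; apply: eq_sweedler => t' t3.
under [RHS]eq_sweedler => h1 h2 do rewrite (linear_sum_sweedler _ _ (lG h1)).
rewrite [RHS]sweedlerC; apply: eq_sweedler => t1 t2.
under [RHS]eq_sweedler => h1 h2 do rewrite (linear_sum_sweedler _ _ (lG h1)).
rewrite [RHS]sweedlerC.
(* [Casimir_counit_colinear] is used at t2 h x', whose coproduct is y1 h1 x1 ⊗ y2 h2 x2;
   coassociativity of the coaction then matches this with [GM]. *)
transitivity (\sw_(x0 ⊗ x' <- coact t1) \sw_(x1 ⊗ x2 <- comul x')
  \sw_(h1 ⊗ h2 <- comul h) \sw_(y1 ⊗ y2 <- comul t2)
  \sw_(b ⊗ l <- B ((y2 * h2 * x2) ⊗ t3)) \sw_(b0 ⊗ b1 <- coact b)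
    (x0 * b0) ⊗ (l * (y1 * h1 * x1) * b1)).
  apply: eq_sweedler => x0 x'.
  pose F (v : (A ⊗ H)%type) : A ⊗ H := \sw_(a ⊗ z <- v) (x0 * a) ⊗ z.
  have bF : is_bilinear (fun a (z : H) => (x0 * a) ⊗ z) by lin.
  have lF : linear F := sweedler_linear bF.
  have FE a z : F (a ⊗ z) = (x0 * a) ⊗ z := sweedlerE bF a z.
  under [LHS]eq_sweedler do rewrite -FE.
  rewrite -(linear_sum_sweedler _ _ lF) Casimir_counit_colinear.
  rewrite sw_comulM; last by lin.
  rewrite sw_comulM; last by lin.
  rewrite (linear_sum_sweedler _ _ lF) [RHS]sweedlerC.
  under [RHS]eq_sweedler do rewrite sweedlerC.
  rewrite [RHS]sweedlerC; apply: eq_sweedler => y1 y2.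
  rewrite (linear_sum_sweedler _ _ lF); apply: eq_sweedler => h1 h2.
  rewrite (linear_sum_sweedler _ _ lF); apply: eq_sweedler => x1 x2.
  rewrite (linear_sum_sweedler _ _ lF); apply: eq_sweedler => b l.
  rewrite (linear_sum_sweedler _ _ lF); apply: eq_sweedler => b0 b1.
  by rewrite FE !mulrA.
rewrite -sw_coactA; try by lin.
apply: eq_sweedler => x' x2.
rewrite [LHS]sweedlerC; apply: eq_sweedler => h1 h2.
rewrite [LHS]sweedlerC (linear_sum_sweedler _ _ (lG h1)).
apply: eq_sweedler => y1 y2.
rewrite GM [LHS]sweedlerC; apply: eq_sweedler => b l.
by apply: eq_sweedler => x0 x1.
Qed.

End FrobeniusAntipode.

(** * From the Frobenius property to the inverse of the antipode *)

Theorem theorem3p12 (k : fieldType) (H : hopfAlgType k) (A : comodAlgType H) :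
  Frobenius H A -> h_separable H A.
Proof.
case=> B [t [casB _ _ tB]].
have [A0|A1] := eqVneq (1 : A) 0.
  have trivial_tens (u : (A ⊗ H)%type) : u = 0.
    by rewrite -[u]mul1r -[1 * u]/(((1 : A) ⊗ (1 : H)) * u)
      A0 -(scale0r 0) tensZl scale0r mul0r.
  exists B; split=> // [h|h h' h''].
    by rewrite [LHS]trivial_tens [RHS]trivial_tens.
  by rewrite [LHS]trivial_tens [RHS]trivial_tens.
have [phi phi1] := ex_dual_vector A1.
(* [T] comes from the formula for 1 ⊗ h: move t2 h x1 across with [Casimir_counit], replace S(h) by
   a variable y, and apply [phi] to the A-component. *)
pose T (y : H) : H := \sw_(t1 ⊗ t2 ⊗ t3 <- t)
  \sw_(x0 ⊗ x1 <- coact t1) \sw_(z1 ⊗ z2 <- comul t3)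
    (phi (x0 * tens_counit (B (1 ⊗ (antipode x1 * y * antipode t2 * z1)))) : k)
      *: z2.
have le := @tens_counit_linear _ H A.
(* In each term y occurs only inside the scalar given by [phi], so every term has rank at most
   one. *)
have rankT : finite_rank T.
  do 4![apply: finite_rank_sweedler => ? ?].
  by apply: finite_rank_scalel; lin.
have TK : cancel antipode T.
  move=> h; pose F (u : (A ⊗ H)%type) : H := \sw_(a ⊗ z <- u) (phi a : k) *: z.
  have bF : is_bilinear (fun (a : A) (z : H) => (phi a : k) *: z) by lin.
  have lF : linear F := sweedler_linear bF.
  have FE a z : F (a ⊗ z) = (phi a : k) *: z := sweedlerE bF a z.
  rewrite -[RHS]scale1r -phi1 -FE -(Frobenius_dual_basis casB tB).
  do 4![rewrite (linear_sum_sweedler _ _ lF); apply: eq_sweedler => ? ?].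
  by rewrite FE [in RHS]Casimir_counit // !antipodeM !mulrA.
(* Surjectivity of the antipode turns its left inverse [T] into a two-sided one. *)
apply: h_separable_of_bijective_antipode; exists T => // h.
have [g ->] := surjective_of_finite_rank_retraction TK rankT h.
by rewrite TK.
Qed.
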